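(* Let $(P,K)$ have the limiting joint law of $(P_n,K_n)$ as $n\to\infty$, and let $S=PK$. For every integer $s\ge1$, $$\mathbb P(S=s)=2^{-s}\sum_{d\mid s}(1-2^{-d}).$$ Equivalently, $$\mathbb P(S=s)=2^{-s}\Bigl(\tau(s)-\sum_{d\mid s}2^{-d}\Bigr),$$ where $\tau(s)$ is the number of positive divisors of $s$.
   Context: $\mathcal C_n$ is the set of integer compositions of $n$, i.e. ordered sequences $\alpha=(a_1,\ldots,a_\ell)$ of integers $a_i\ge1$ with sum $n$. The initial run of $\alpha$ is the maximal prefix $(a_1,\ldots,a_k)$ whose entries are all equal; $P(\alpha)=a_1$ and $K(\alpha)=k$ is the number of parts in it. For each $n\ge1$, $\alpha_n$ is uniformly distributed on $\mathcal C_n$, $P_n=P(\alpha_n)$ and $K_n=K(\alpha_n)$. The pair $(P,K)$ of positive-integer random variables has the joint law $\mathbb P(P=p,K=k)=\lim_{n\to\infty}\mathbb P(P_n=p,K_n=k)$ for $p,k\ge1$ (these pointwise limits exist and form a probability distribution). Sums over $d\mid s$ are over positive divisors. *)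

(* Defs.v *)
From HB Require Import structures.
From mathcomp Require Import all_boot all_order all_algebra.
From mathcomp Require Import all_classical all_reals all_analysis.
Set Implicit Arguments.
Unset Strict Implicit.
Unset Printing Implicit Defensive.
Import Order.TTheory GRing.Theory Num.Theory.
Import numFieldNormedType.Exports.
Local Open Scope ring_scope.

Definition is_composition (n : nat) (a : seq nat) : bool :=
  all (fun x => 0 < x)%N a && (sumn a == n).

Definition parts (n : nat) (a : n.-bseq 'I_n.+1) : seq nat :=
  [seq nat_of_ord x | x <- a].

(* A composition of n has at most n parts, each at most n, so the finite type
   n.-bseq 'I_n.+1 is large enough to hold all of them (compositionsP); this
   encoding is faithful since parts is injective (parts_inj). *)
Definition compositions (n : nat) : {set n.-bseq 'I_n.+1} :=
  [set a | is_composition n (parts a)].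

Lemma parts_inj (n : nat) : injective (@parts n).
Proof. by move=> a b /(inj_map val_inj) /val_inj. Qed.

Lemma compositionsP (n : nat) (s : seq nat) :
  reflect (exists2 a, a \in compositions n & parts a = s) (is_composition n s).
Proof.
apply: (iffP idP) => [sn|[a]]; last by rewrite inE => + <-.
have /andP[s0 /eqP sumE] := sn.
have szs : (size s <= n)%N.
  rewrite -sumE; elim: s s0 {sn sumE} => //= x s IH /andP[x0 /IH].
  by rewrite -add1n; apply: leq_add.
have ltn s' x : (x \in s' -> x <= sumn s')%N.
  elim: s' => //= y s' IH; rewrite inE => /predU1P[->|/IH xs].
    exact: leq_addr.
  exact: leq_trans xs (leq_addl _ _).
have szt : (size [seq inord x : 'I_n.+1 | x <- s] <= n)%N by rewrite size_map.
have pE : parts (Bseq szt) = s.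
  rewrite /parts /= -map_comp -[RHS]map_id; apply/eq_in_map => x xs /=.
  by rewrite inordK// ltnS -sumE ltn.
by exists (Bseq szt) => //; rewrite inE pE.
Qed.

Definition initP (a : seq nat) : nat := head 0%N a.

(* find returns the size of a when all its entries are equal. *)
Definition initK (a : seq nat) : nat := find (fun x => x != initP a) a.

(* P(P_n = p, K_n = k) for alpha_n uniformly distributed on compositions n. *)
Definition prob_PK (R : realType) (n p k : nat) : R :=
  #|[set a in compositions n | (initP (parts a) == p) && (initK (parts a) == k)]|%:R
  / #|compositions n|%:R.

(* Main.v *)
Require Import Defs.
From HB Require Import structures.
From mathcomp Require Import all_boot all_order all_algebra.
From mathcomp Require Import all_classical all_reals all_analysis.
From mathcomp Require Import ring.
Import Order.TTheory GRing.Theory Num.Theory.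
Import numFieldNormedType.Exports.
Local Open Scope classical_set_scope.
Local Open Scope ring_scope.

(** Compositions of [n] that start with at least [k] copies of [p] are the lists
    obtained by putting [k] copies of [p] in front of a composition of
    [n - p * k].  The event that the initial run has value [p] and length
    exactly [k] is the difference of two such prefix events, for [k] and for
    [k + 1] copies.  Since there are [2 ^ (n - 1)] compositions of [n >= 1],
    the event has, for every [n > p * (k + 1)], probability exactly
      [(2 ^ (n - p * k - 1) - 2 ^ (n - p * (k + 1) - 1)) / 2 ^ (n - 1)
       = 2 ^- (p * k) * (1 - 2 ^- p)]
    ([card_run], [prob_PKE]).  The sequence of probabilities is therefore
    eventually constant, and this constant is the limiting joint law.

    The event [P * K = s] is the disjoint union, over the divisors [d] of [s],
    of the events [P = d, K = s / d], each of probability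
    [2 ^- s * (1 - 2 ^- d)]; finite additivity gives the formula.

    The counting is done on a duplicate-free list of lists of numbers
    ([compseq]) so that bijections between sets of compositions of different
    integers are plain list functions ([count_compseq_inj]). *)

Definition compseq (n : nat) : seq (seq nat) :=
  [seq parts a | a <- enum (compositions n)].

Lemma mem_compseq n s : (s \in compseq n) = is_composition n s.
Proof.
apply/mapP/idP => [[a + ->]|/compositionsP[a aC <-]].
  by rewrite mem_enum inE.
by exists a; rewrite ?mem_enum.
Qed.

Lemma compseq_uniq n : uniq (compseq n).
Proof. by rewrite map_inj_uniq ?enum_uniq//; exact: parts_inj. Qed.

Lemma card_compositions n : #|compositions n| = size (compseq n).
Proof. by rewrite size_map -cardE. Qed.

Lemma card_compositions_count n (Q : pred (seq nat)) :
  #|[set a in compositions n | Q (parts a)]%SET| = count Q (compseq n).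
Proof.
rewrite cardE count_map -size_filter; apply: perm_size; apply: uniq_perm.
- exact: enum_uniq.
- by rewrite filter_uniq ?enum_uniq.
by move=> a; rewrite [LHS]mem_enum mem_filter mem_enum inE andbC.
Qed.

(** Meant for an [f] that makes a composition of a larger integer out of one of
    a smaller integer: the insertion of a prefix, or the increment of the first
    part. *)
Lemma count_compseq_inj m n (Q : pred (seq nat)) (f : seq nat -> seq nat) :
    {in compseq m &, injective f} ->
    (forall t, is_composition n t && Q t <->
       exists2 u, is_composition m u & t = f u) ->
  count Q (compseq n) = size (compseq m).
Proof.
move=> f_inj QP; rewrite -(size_map f) -size_filter.
apply: perm_size; apply: uniq_perm.
- by rewrite filter_uniq ?compseq_uniq.
- by rewrite map_inj_in_uniq ?compseq_uniq.
move=> t; rewrite mem_filter mem_compseq andbC.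
apply/idP/mapP => [/QP[u uC ->]|[u]]; first by exists u; rewrite ?mem_compseq.
by rewrite mem_compseq => uC ->; apply/QP; exists u.
Qed.

Lemma count_prefix_nseq p k n : (0 < p)%N -> (p * k <= n)%N ->
  count (prefix (nseq k p)) (compseq n) = size (compseq (n - p * k)).
Proof.
move=> p0 pkn; apply: (@count_compseq_inj _ _ _ (cat (nseq k p))).
  by move=> u v _ _ /eqP; rewrite eqseq_cat// eqxx => /eqP.
have compE u : is_composition n (nseq k p ++ u) = is_composition (n - p * k) u.
  rewrite /is_composition all_cat all_nseq p0 orbT/= sumn_cat sumn_nseq.
  by rewrite -(eqn_add2l (p * k)%N (sumn u)) subnKC.
move=> t; split=> [/andP[+ /prefixP[u tE]]|[u uC ->]].
  by rewrite tE compE => uC; exists u.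
by rewrite compE uC prefix_prefix.
Qed.

(** When the first part exceeds 1, decreasing it by 1 is reversible. *)
Lemma count_no_prefix1 n :
  count (fun t => ~~ prefix [:: 1%N] t) (compseq n.+2) = size (compseq n.+1).
Proof.
apply: (@count_compseq_inj _ _ _ (fun u => (head 0 u).+1 :: behead u)).
  by move=> [|x u] [|y v]; rewrite !mem_compseq// => _ _ [-> ->].
move=> t; split=> [|[[|x u]//]].
  case: t => [|[|[|x]] t]//=; rewrite ?prefix0s ?eqxx ?andbF//.
  rewrite andbT /is_composition/= addSn eqSS => tC.
  by exists (x.+1 :: t).
rewrite /is_composition/= => /andP[/andP[x0 u0] /eqP uE] ->.
by rewrite /= u0 addSn uE eqxx; case: x x0 {uE}.
Qed.

(** By induction: a composition of [n + 2] either starts with 1, and deleting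
    that part leaves an arbitrary composition of [n + 1], or it does not, and
    [count_no_prefix1] applies. *)
Lemma size_compseq n : size (compseq n.+1) = (2 ^ n)%N.
Proof.
elim: n => [|n IHn].
  have: perm_eq (compseq 1) [:: [:: 1%N]].
    apply: uniq_perm; rewrite ?compseq_uniq// => t; rewrite mem_compseq inE.
    by case: t => [|[|[|x]] [|[|y] t]]; rewrite /is_composition//= ?addSn ?andbF.
  by move/perm_size.
rewrite -(count_predC (prefix (nseq 1 1%N))) count_prefix_nseq// subn1/=.
by rewrite count_no_prefix1 IHn addnn -mul2n expnS.
Qed.

(** Turns the run statistics into prefix conditions, for which
    [count_prefix_nseq] gives the count. *)
Lemma prefix_nseq p k a :
  prefix (nseq k.+1 p) a = (initP a == p) && (k < initK a)%N.
Proof.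
case: a => [|x a]; first by rewrite prefixs0 andbF.
rewrite /initP /initK/= eqxx/= ltnS eq_sym; case: eqP => //= ->.
elim: k a => [|k IHk] [|y a]//=.
by rewrite eq_sym; case: eqVneq => //= ->; rewrite IHk.
Qed.

(** The compositions whose run is exactly [k] copies of [p] and those that start
    with [k + 1] copies together form those that start with [k] copies; the
    last two classes have [2 ^ m] and [2 ^ (m + p)] elements.  An addition
    avoids truncated subtraction. *)
Lemma card_run p k m : (0 < p)%N -> (0 < k)%N ->
  let n := (m + p * k.+1).+1 in
  (#|[set a in compositions n |
      (initP (parts a) == p) && (initK (parts a) == k)]%SET| + 2 ^ m
   = 2 ^ (m + p))%N.
Proof.
case: k => // k p0 _ n.
rewrite (card_compositions_count _ (fun a => (initP a == p) && (initK a == k.+1))).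
have kE : (p * k.+1 <= n)%N.
  by rewrite leqW// (leq_trans _ (leq_addl _ _))// leq_mul2l leqW ?orbT.
have := count_prefix_nseq _ _ _ p0 kE; rewrite (eq_count (prefix_nseq p k)).
have -> : (n - p * k.+1 = (m + p).+1)%N.
  by rewrite /n (mulnS p k.+1) addnA -addSn addnK.
rewrite size_compseq => <-.
have := count_prefix_nseq p k.+2 n p0 (leqW (leq_addl _ _)).
rewrite (eq_count (prefix_nseq p k.+1)) /n -addSn addnK size_compseq => <-.
(* The two classes on the left are disjoint, so their counts add up. *)
rewrite -count_predUI [X in (_ + X)%N](@eq_count _ _ pred0) ?count_pred0 ?addn0; last first.
  move=> t /=; case: (_ == p) => //=.
  by case: ltngtP; rewrite ?andbF.
apply: eq_count => t /=; case: (_ == p) => //=.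
by case: (ltngtP (initK t) k.+1); rewrite ?orbT// ltnS leqNgt => ->.
Qed.

(** Holds exactly, not just asymptotically: once [n] exceeds [p * (k + 1)],
    both prefix counts are genuine powers of 2 and [n] cancels. *)
Lemma prob_PKE (R : realType) p k n : (0 < p)%N -> (0 < k)%N ->
  (p * k.+1 < n)%N ->
  prob_PK R n p k = 2 ^- (p * k) * (1 - 2 ^- p).
Proof.
move=> p0 k0 /subnK nE; set m := (n - _)%N in nE.
rewrite -nE addnS /prob_PK card_compositions size_compseq.
have /(congr1 (fun x => x%:R : R)) := card_run p k m p0 k0.
rewrite natrD !natrX => /(canRL (addrK _)) ->.
rewrite mulnS !exprD.
have X0 i : (2 ^+ i : R) != 0 by rewrite expf_neq0// pnatr_eq0.
by field; rewrite !X0.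
Qed.

Lemma cvg_prob_PK (R : realType) p k : (0 < p)%N -> (0 < k)%N ->
  (prob_PK R n p k)%:E @[n --> \oo] --> (2 ^- (p * k) * (1 - 2 ^- p) : R)%:E.
Proof.
move=> p0 k0; apply: cvg_near_cst; exists (p * k.+1).+1 => // n /= nE.
by rewrite prob_PKE.
Qed.

Theorem theorem5p5 (R : realType) (disp : measure_display)
    (Omega : measurableType disp) (Pr : probability Omega R)
    (P K : {RV Pr >-> nat})
    (P_gt0 : forall w : Omega, (0 < P w)%N)
    (K_gt0 : forall w : Omega, (0 < K w)%N)
    (PK_law : forall p k : nat, (0 < p)%N -> (0 < k)%N ->
      (prob_PK R n p k)%:E @[n --> \oo]
        --> Pr [set w : Omega | P w = p /\ K w = k])
    (s : nat) (s_gt0 : (0 < s)%N) :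
  Pr [set w : Omega | (P w * K w)%N = s]
    = (2 ^- s * \sum_(d <- divisors s) (1 - 2 ^- d))%:E
  /\
  Pr [set w : Omega | (P w * K w)%N = s]
    = (2 ^- s * ((size (divisors s))%:R - \sum_(d <- divisors s) 2 ^- d))%:E.
Proof.
have lawE p k : (0 < p)%N -> (0 < k)%N ->
    Pr [set w | P w = p /\ K w = k] = (2 ^- (p * k) * (1 - 2 ^- p))%:E.
  move=> p0 k0.
  exact: (cvg_unique _ (PK_law _ _ p0 k0) (cvg_prob_PK R _ _ p0 k0)).
have sumE : \sum_(d <- divisors s) (1 - 2 ^- d)
    = (size (divisors s))%:R - \sum_(d <- divisors s) 2 ^- d :> R.
  by rewrite sumrB big_const_seq count_predT iter_addr_0.
rewrite -sumE; suff SE : Pr [set w | (P w * K w)%N = s]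
    = (2 ^- s * \sum_(d <- divisors s) (1 - 2 ^- d))%:E by [].
(* On [P * K = s] the value of [P] is a divisor [d] of [s], and as [d > 0] it
   determines [K]. *)
have -> : [set w | (P w * K w)%N = s] =
    \bigcup_(d in [set` divisors s]) [set w | P w = d /\ K w = (s %/ d)%N].
  apply/seteqP; split=> w /= => [PKs|[d /= + [-> ->]]].
    exists (P w) => /=; first by rewrite -dvdn_divisors// -PKs dvdn_mulr.
    by rewrite -PKs mulKn.
  by rewrite -dvdn_divisors// => /divnK; rewrite mulnC.
rewrite (measure_fin_bigcup _ (finite_seq _)); last 2 first.
- by move=> d e _ _ [w [[/= <- _] [/= <- _]]].
- move=> d _; rewrite [X in measurable X](_ : _ =
    P @^-1` [set d] `&` K @^-1` [set (s %/ d)%N])//.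
  by apply: measurableI; apply: measurable_funPTI.
rewrite -fsbig_seq ?divisors_uniq//= big_distrr/= -sumEFin.
apply: eq_big_seq => d; rewrite -dvdn_divisors// => ds.
have d0 := dvdn_gt0 s_gt0 ds.
have sd0 : (0 < s %/ d)%N by rewrite divn_gt0// dvdn_leq.
have := lawE _ _ d0 sd0.
by rewrite (_ : (d * (s %/ d))%N = s)// mulnC divnK.
Qed.
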